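(* For each $n\geq 1$, the full transformation monoid $T_n$ of all maps $\{1,\ldots,n\}\to\{1,\ldots,n\}$ (under composition) is normally simple.
   Context: For a monoid $M$ with identity $1$, $U(M)$ denotes its group of units (elements with a two-sided inverse). A groupal submonoid of $M$ is a submonoid $S\subseteq M$ such that $x^{-1}\in S$ for every $x\in S\cap U(M)$. For $A\subseteq M$ and $x,y\in M$, $xAy=\{xay : a\in A\}$. A subset $A\subseteq M$ is invariant if for each $x,y\in M$ the following three conditions are equivalent: (i) $xAy\subseteq A$; (ii) $xy\in A$; (iii) $(xAy)\cap A\neq\emptyset$. A normal submonoid of $M$ is a submonoid which is both groupal and invariant. A monoid $M$ is called normal when $U(M)$ is a normal submonoid of $M$. A normal monoid $M$ is called normally simple if its only normal submonoids are $M$ and the normal subgroups of $U(M)$. *)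

(* Defs.v *)
From HB Require Import structures.
From mathcomp Require Import all_boot.
From mathcomp Require Import boolp classical_sets.

Set Implicit Arguments.
Unset Strict Implicit.
Unset Printing Implicit Defensive.

Local Open Scope classical_set_scope.
Local Open Scope group_scope.

Section NormalMonoids.
Variable M : monoidType.
Implicit Types (A S N : set M) (x y : M).

Definition two_sided_inverse x y : Prop := x * y = 1 /\ y * x = 1.

Definition units : set M := [set x | exists y, two_sided_inverse x y].

Definition translate x A y : set M := [set x * a * y | a in A].

Definition submonoid S : Prop := monoid_closed (mem S).

Definition inverse_closed S : Prop :=
  forall x y, S x -> two_sided_inverse x y -> S y.

Definition groupal_submonoid S : Prop := submonoid S /\ inverse_closed S.

Definition invariant_subset A : Prop :=
  forall x y,
    (translate x A y `<=` A <-> A (x * y)) /\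
    (A (x * y) <-> translate x A y `&` A !=set0).

Definition normal_submonoid S : Prop :=
  groupal_submonoid S /\ invariant_subset S.

(* In the last clause, y is the inverse of x, so that translate x N y is the
   conjugate of N by x. *)
Definition normal_subgroup_of_units N : Prop :=
  [/\ N `<=` units, submonoid N, inverse_closed N
    & forall x y, two_sided_inverse x y -> translate x N y `<=` N].

End NormalMonoids.

Arguments units : clear implicits.

Definition normal_monoid (M : monoidType) : Prop := normal_submonoid (units M).

Definition normally_simple (M : monoidType) : Prop :=
  normal_monoid M /\
  forall S : set M,
    normal_submonoid S <-> S = setT \/ normal_subgroup_of_units S.

(* T_n on the point set 'I_n = {0, ..., n - 1}; the product f * g is the
   composite f \o g, i.e. g is applied first. The definition is a separate
   constant so that the monoid structure below is keyed on it, and not on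
   finite functions, whose library monoid structures are pointwise. *)
Definition full_transformation (n : nat) : Type := {ffun 'I_n -> 'I_n}.

Section FullTransformationMonoid.
Variable n : nat.

HB.instance Definition _ := Finite.copy (full_transformation n)
  {ffun 'I_n -> 'I_n}.

Definition transf_mul (f g : full_transformation n) : full_transformation n :=
  [ffun i : 'I_n => (f : {ffun 'I_n -> 'I_n}) ((g : {ffun 'I_n -> 'I_n}) i)].

Definition transf_one : full_transformation n := [ffun i : 'I_n => i].

Lemma transf_mulA : associative transf_mul.
Proof. by move=> f g h; apply/ffunP => i; rewrite !ffunE. Qed.

Lemma transf_mul1g : left_id transf_one transf_mul.
Proof. by move=> f; apply/ffunP => i; rewrite !ffunE. Qed.

Lemma transf_mulg1 : right_id transf_one transf_mul.
Proof. by move=> f; apply/ffunP => i; rewrite !ffunE. Qed.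

HB.instance Definition _ := isMonoid.Build (full_transformation n)
  transf_mulA transf_mul1g transf_mulg1.

End FullTransformationMonoid.

(* Main.v *)
(** A nonunit of [T_n] identifies two points, so conjugates of a nonunit of [S]
    can be used to lower the rank of any nonconstant element of [S]: hence [S]
    contains a constant map, then by conjugation all of them. As [x * c] is
    constant for every [x] and every constant [c], invariance puts [x] in [S]. *)

Require Import Defs.
From mathcomp Require Import all_boot.
From mathcomp Require Import fingroup perm.
From mathcomp Require Import boolp classical_sets.

Set Implicit Arguments.
Unset Strict Implicit.
Unset Printing Implicit Defensive.

Local Open Scope classical_set_scope.
Local Open Scope group_scope.

Section Monoid.
Variable M : monoidType.
Implicit Types (S N : set M) (x y : M).

Lemma submonoidP S :
  submonoid S <-> S 1 /\ forall x y, S x -> S y -> S (x * y).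
Proof.
split=> -[S1 SM]; split; first by rewrite inE in S1.
- by move=> x y Sx Sy; have := SM x y; rewrite !inE; apply.
- by rewrite inE.
- by move=> x y; rewrite !inE; apply: SM.
Qed.

Lemma two_sided_inverse1 : two_sided_inverse (1 : M) 1.
Proof. by split; rewrite mul1g. Qed.

Lemma two_sided_inverseC x y : two_sided_inverse x y -> two_sided_inverse y x.
Proof. by case. Qed.

Lemma two_sided_inverseM x x' y y' : two_sided_inverse x x' ->
  two_sided_inverse y y' -> two_sided_inverse (x * y) (y' * x').
Proof.
move=> [xx' x'x] [yy' y'y]; split.
- by rewrite mulgA -(mulgA x) yy' mulg1.
- by rewrite mulgA -(mulgA y') x'x mulg1.
Qed.

(** Since [x * y = 1] lies in [S], condition (ii) of invariance holds for [x] and [y], and (i)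
    follows. *)
Lemma normal_submonoid_conj S x y a :
  normal_submonoid S -> two_sided_inverse x y -> S a -> S (x * a * y).
Proof.
move=> [[/submonoidP[S1 _] _] invS] [xy _] Sa.
by apply: (proj2 (proj1 (invS x y))); [rewrite xy | exists a].
Qed.

(** Invariance with [y = 1]: the element [x * a] witnesses that [translate x S 1] meets [S], so
    (iii) gives (ii). *)
Lemma normal_submonoid_cancelr S x a :
  normal_submonoid S -> S a -> S (x * a) -> S x.
Proof.
move=> [_ invS] Sa Sxa; rewrite -[x]mulg1; apply/(proj2 (invS x 1)).
by exists (x * a); split=> //; exists a; rewrite ?mulg1.
Qed.

Lemma normal_submonoidT : normal_submonoid (@setT M).
Proof.
split; first by split=> //; apply/submonoidP.
by move=> x y; split; split=> // _; exists (x * 1 * y); split=> //; exists 1.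
Qed.

Lemma normal_submonoid_of_units S : S `<=` units M -> normal_submonoid S ->
  normal_subgroup_of_units S.
Proof.
move=> SU nS; have [[Sm Si] _] := nS; split=> // x y xy _ [a Sa <-].
exact: normal_submonoid_conj.
Qed.

(** This excludes one-sided inverses, as in the bicyclic monoid; for transformations of a finite set
    it is [transf_unit_factors]. *)
Hypothesis units_factors : forall x y, units M (x * y) ->
  units M x /\ units M y.

(** If [x * y] or [x * a * y] lies in [N], then [x] is a unit, with inverse [x'], and [x * a * y] is
    the product of the conjugate [x * a * x'] and [x * y]. As [N] is closed under conjugation,
    products and inverses, either element lies in [N] as soon as the other does. *)
Lemma normal_subgroup_normal_submonoid N :
  normal_subgroup_of_units N -> normal_submonoid N.
Proof.
move=> [NU Nm Ni NJ]; have [N1 NM] := (submonoidP N).1 Nm.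
split=> // x y; split; split.
- by move=> sub; apply: sub; exists 1; rewrite ?mulg1.
- move=> Nxy _ [a Na <-]; have [[x' xx'] _] := units_factors (NU _ Nxy).
  have -> : x * a * y = x * a * x' * (x * y).
    by rewrite mulgA -(mulgA (x * a)) xx'.2 mulg1.
  by apply: NM => //; apply: (NJ _ _ xx'); exists a.
- by move=> Nxy; exists (x * y); split=> //; exists 1; rewrite ?mulg1.
- move=> [_ [[a Na <-] Nxay]]; have [a' aa'] := NU _ Na.
  have [[x' xx'] _] := units_factors (units_factors (NU _ Nxay)).1.
  have -> : x * y = x * a' * x' * (x * a * y).
    by rewrite !mulgA -(mulgA (x * a')) xx'.2 mulg1 -(mulgA x) aa'.2 mulg1.
  apply: NM => //; apply: (NJ _ _ xx'); exists a' => //; exact: Ni Na aa'.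
Qed.

Lemma normal_subgroup_units : normal_subgroup_of_units (units M).
Proof.
have UM x y : units M x -> units M y -> units M (x * y).
  by move=> [x' xx'] [y' yy']; exists (y' * x'); apply: two_sided_inverseM.
split=> //.
- by apply/submonoidP; split=> //; exists 1; apply: two_sided_inverse1.
- by move=> x y _ xy; exists x; apply: two_sided_inverseC.
- move=> x y xy _ [a Ua <-]; have Ux : units M x by exists y.
  have Uy : units M y by exists x; apply: two_sided_inverseC.
  by apply: (UM) Uy; apply: UM.
Qed.

End Monoid.

Section FullTransformation.
Variable n : nat.
Implicit Types (f g : full_transformation n) (S : set (full_transformation n)).

Definition transf_fun f : 'I_n -> 'I_n := fun_of_fin (f : {ffun 'I_n -> 'I_n}).
Local Coercion transf_fun : full_transformation >-> Funclass.

Lemma transfP f g : f =1 g <-> f = g.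
Proof. by split=> [fg | -> //]; apply/ffunP. Qed.

Lemma transf_mulE f g i : transf_fun (f * g) i = f (g i).
Proof. exact: ffunE. Qed.

Lemma transf_oneE i : transf_fun 1 i = i.
Proof. exact: ffunE. Qed.

Definition transf_of (h : 'I_n -> 'I_n) : full_transformation n := [ffun i => h i].

Lemma transf_ofE h i : transf_of h i = h i.
Proof. exact: ffunE. Qed.

Lemma transf_of_inverse h k : cancel h k -> cancel k h ->
  two_sided_inverse (transf_of h) (transf_of k).
Proof.
by move=> hk kh; split; apply/transfP => i;
  rewrite transf_oneE transf_mulE !transf_ofE ?hk ?kh.
Qed.

(** An injective self-map of the finite set ['I_n] is bijective, with two-sided inverse [invF]. *)
Lemma transf_unitP f : units (full_transformation n) f <-> injective f.
Proof.
split=> [[g [_ gf]] | f_inj].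
  by apply: (can_inj (g := transf_fun g)) => i; rewrite -transf_mulE gf transf_oneE.
have fE : transf_of f = f by apply/transfP => i; rewrite transf_ofE.
exists (transf_of (invF f_inj)); rewrite -[X in two_sided_inverse X]fE.
apply: transf_of_inverse; [exact: invF_f | exact: f_invF].
Qed.

Lemma transf_unit_factors f g : units (full_transformation n) (f * g) ->
  units (full_transformation n) f /\ units (full_transformation n) g.
Proof.
move=> /transf_unitP fg_inj.
have g_inj : injective g.
  by move=> i j gij; apply: fg_inj; rewrite !transf_mulE gij.
split; apply/transf_unitP => // i j.
(* By finiteness [g] is bijective, so each point is a value of [g], and [f] inherits injectivity
   from [f * g]. *)
rewrite -[i](f_invF g_inj) -[j](f_invF g_inj) -!transf_mulE.
by move=> /fg_inj ->.
Qed.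

Definition transf_const (c : 'I_n) : full_transformation n := transf_of (fun=> c).

Lemma mul_transf_const f c : f * transf_const c = transf_const (f c).
Proof. by apply/transfP => i; rewrite transf_mulE !transf_ofE. Qed.

(** The first transposition sends [p] to [i]; the second sends the new position of [q] to [j] and
    fixes [i], which differs from both. *)
Lemma perm_moving_pair (T : finType) (p q i j : T) : p != q -> i != j ->
  exists s : {perm T}, s p = i /\ s q = j.
Proof.
move=> pq ij; exists (tperm p i * tperm (tperm p i q) j); rewrite !permM.
split; last by rewrite tpermL.
rewrite tpermL tpermD 1?eq_sym //; apply: contra_neq pq => e.
by apply: (@perm_inj _ (tperm p i)); rewrite tpermL.
Qed.

Lemma transf_perm_inverse (s : {perm 'I_n}) :
  two_sided_inverse (transf_of s^-1) (transf_of s).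
Proof. by apply: transf_of_inverse; [exact: permKV | exact: permK]. Qed.

Lemma normal_submonoid_const_mem S a : normal_submonoid S -> (0 < n)%N -> S a ->
  ~ injective a -> exists c, S (transf_const c).
Proof.
move=> nS n_gt0 Sa a_ninj.
have [i [j [aij ij]]] : exists i j, a i = a j /\ i != j.
  apply: contrapT => no_pair; apply: a_ninj => i j aij; apply/eqP/negPn/negP => ij.
  by apply: no_pair; exists i, j.
have [[/submonoidP[_ SM] _] _] := nS.
suff rank_induction k b : S b -> (#|transf_fun b @: [set: 'I_n]%SET| <= k)%N ->
    exists c, S (transf_const c).
  exact: (rank_induction _ a Sa (leqnn _)).
(* Induction on a bound for the rank of [b]; rank 0 is impossible because ['I_n] is nonempty. *)
elim: k b => [|k IHk] b Sb rank_b.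
  move: rank_b; rewrite leqn0 cards_eq0 => /eqP/setP/(_ (b (Ordinal n_gt0))).
  by rewrite imset_f ?inE.
have [b_const | b_nconst] := pselect (forall p q, b p = b q).
  exists (b (Ordinal n_gt0)).
  suff <- : b = transf_const (b (Ordinal n_gt0)) by [].
  by apply/transfP => p; rewrite transf_ofE.
have [p [q bpq]] : exists p q, b p != b q.
  apply: contrapT => no_pair; apply: b_nconst => p q; apply/eqP/negPn/negP => bpq.
  by apply: no_pair; exists p, q.
(* [s] carries two distinct values of [b] to the points [i] and [j] that [a] merges, so the
   conjugate [d] merges those values. *)
have [s [sp sq]] := perm_moving_pair bpq ij.
pose d : full_transformation n := transf_of s^-1 * a * transf_of s.
have dpq : d (b p) = d (b q) by rewrite !transf_mulE !transf_ofE sp sq aij.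
apply: (IHk (d * b)).
  apply: SM => //; exact: normal_submonoid_conj (transf_perm_inverse s) Sa.
rewrite -ltnS; apply: leq_trans rank_b.
have -> : transf_fun (d * b) @: [set: 'I_n]%SET = d @: (b @: [set: 'I_n]%SET).
  by rewrite -imset_comp; apply: eq_imset => x /=; rewrite transf_mulE.
(* Equal cardinalities would make [d] injective on the image of [b], against [dpq]. *)
rewrite ltn_neqAle leq_imset_card andbT.
apply/negP => /imset_injP d_inj; move/eqP: bpq; apply.
by apply: d_inj; rewrite ?imset_f ?inE.
Qed.

Lemma normal_submonoid_const_full S c :
  normal_submonoid S -> S (transf_const c) -> S = setT.
Proof.
move=> nS Sc.
have S_const c' : S (transf_const c').
  (* Right multiplication leaves a constant map unchanged, and left multiplication by the
     transposition moves its value from [c] to [c']. *)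
  have := normal_submonoid_conj nS (transf_perm_inverse (tperm c c')) Sc.
  suff -> : transf_of (tperm c c')^-1 * transf_const c * transf_of (tperm c c')
    = transf_const c' by [].
  apply/transfP => i; rewrite !transf_mulE !transf_ofE.
  by rewrite tpermV tpermL.
rewrite -subTset => f _; apply: (normal_submonoid_cancelr nS Sc).
by rewrite mul_transf_const.
Qed.

End FullTransformation.

Theorem proposition2p22 (n : nat) (n_ge1 : (1 <= n)%N) :
  normally_simple (full_transformation n).
Proof.
have unit_factors := @transf_unit_factors n.
split.
  (* Normality of the monoid is the case where the normal subgroup is the whole group of units. *)
  apply: normal_subgroup_normal_submonoid => //; exact: normal_subgroup_units.
move=> S; split=> [nS | [-> | ]].
- have [SU | SnU] := pselect (S `<=` units (full_transformation n)).
    by right; apply: normal_submonoid_of_units.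
  left; have [a [Sa a_nunit]] := nonsubset SnU.
  have [|c] := normal_submonoid_const_mem nS n_ge1 Sa.
    by move=> a_inj; apply: a_nunit; apply/transf_unitP.
  exact: normal_submonoid_const_full.
- exact: normal_submonoidT.
- exact: normal_subgroup_normal_submonoid.
Qed.
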